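(* Let $E$ be a real Banach space, let $S=\{S(t)\}_{t\ge 0}$ be a $C_0$-semigroup on $E$ with generator $A$, let $B$ be a bounded linear operator from a real Hilbert space $H$ into $E$, let $P$ be the associated Ornstein-Uhlenbeck semigroup and $P^\circ$ its restriction to $BUC^\circ(E)$. If $A\neq 0$, then there exists $t_0>0$ such that $$\|P^\circ(t)-P^\circ(s)\|_{\mathcal{L}(BUC^\circ(E))}=2$$ for all $0\le t,s\le t_0$ with $t\neq s$.
   Context: Setting. $E^*$ is the dual of $E$; $Q:=BB^*\in\mathcal{L}(E^*,E)$ (with $H$ identified with its dual). For $t\ge 0$, $Q_t\in\mathcal{L}(E^*,E)$ is given by $\langle Q_tx^*,y^*\rangle=\int_0^t\langle S(s)BB^*S^*(s)x^*,y^*\rangle\,ds$ for $x^*,y^*\in E^*$. Standing assumption: for each $t\ge 0$ there is a centred Gaussian Radon measure $\mu_t$ on $E$ with covariance operator $Q_t$, i.e. a Radon probability measure under which every $x^*\in E^*$ is a centred Gaussian random variable with variance $\langle Q_tx^*,x^*\rangle$ (so $\mu_0=\delta_0$). The Ornstein-Uhlenbeck semigroup is $P(t)f(x)=\int_E f(S(t)x+y)\,d\mu_t(y)$ for bounded real-valued continuous $f$ on $E$. $BUC(E)$ is the space of bounded real-valued uniformly continuous functions on $E$ with the supremum norm; it is $P$-invariant. $BUC^\circ(E):=\{f\in BUC(E):\lim_{t\downarrow0}\|P(t)f-f\|=0\}$, a closed $P$-invariant subspace, and $P^\circ$ is the restriction of $P$ to it. $\mathcal{L}(X)$ carries the uniform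 operator norm. *)

(* Defs.v *)
From HB Require Import structures.
From mathcomp Require Import all_boot all_order all_algebra.
From mathcomp Require Import all_classical all_reals all_analysis.

Set Implicit Arguments.
Unset Strict Implicit.
Unset Printing Implicit Defensive.

Import Order.TTheory GRing.Theory Num.Theory.
Import numFieldTopology.Exports numFieldNormedType.Exports.

Local Open Scope classical_set_scope.
Local Open Scope ring_scope.

(* Together with completeness of H, this makes H a real Hilbert space. *)
Definition inner_product (R : realType) (H : normedModType R)
    (ip : H -> H -> R) : Prop :=
  [/\ forall a u v w, ip (a *: u + v) w = a * ip u w + ip v w,
      forall u v, ip u v = ip v u
    & forall u, ip u u = `|u| ^+ 2].

(* Only the values S t with 0 <= t are relevant. *)
Definition C0_semigroup (R : realType) (E : normedModType R)
    (S : R -> {linear E -> E}) : Prop :=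
  [/\ forall t, 0 <= t -> continuous (S t),
      forall x, S 0 x = x,
      forall t s x, 0 <= t -> 0 <= s -> S (t + s) x = S t (S s x)
    & forall x, S t x @[t --> 0^'+] --> x].

Section Generator.
Context {R : realType} {E : normedModType R}.
Variable S : R -> {linear E -> E}.

Definition diff_quotient (x : E) (t : R) : E := t^-1 *: (S t x - x).

Definition generator_domain : set E :=
  [set x | cvg (diff_quotient x t @[t --> 0^'+])].

Definition generator (x : E) : E := lim (diff_quotient x t @[t --> 0^'+]).

End Generator.

Section Covariance.
Context {R : realType} {E H : completeNormedModType R}.
Variables (ip : H -> H -> R) (S : R -> {linear E -> E}) (B : {linear H -> E}).

(* B^* x^* in H, where H is identified with its dual: the Riesz representative
   of the functional k |-> x^*(B k). *)
Definition adjoint (x : E -> R) : H :=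
  xget 0 [set h | forall k, ip h k = x (B k)].

(* Q = B B^* *)
Definition Q (x : E -> R) : E := B (adjoint x).

(* The pairing <Q_t x^*, y^*>, which determines Q_t; note that
   S^*(s) x^* is x^* \o S s. *)
Definition Qt_pairing (t : R) (x y : E -> R) : R :=
  \int[lebesgue_measure]_(s in `[0, t]) y (S s (Q (x \o S s))).

End Covariance.

(* E with its Borel sigma-algebra *)
Definition borel (R : realType) (E : normedModType R) :=
  g_sigma_algebraType (@open E).

Definition radon (R : realType) (E : normedModType R)
    (mu : probability (borel E) R) : Prop :=
  forall (A : set (borel E)) (e : R), measurable A -> 0 < e ->
    exists K : set E,
      [/\ compact K, K `<=` A & (mu (A `\` K) < e%:E)%E].

(* N(0, v). The library's normal_prob 0 0 is not the Dirac measure at 0,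
   hence the case distinction. *)
Definition centred_normal (R : realType) (v : R) (A : set R) : \bar R :=
  if v == 0 then dirac (0 : R) A else normal_prob 0 (Num.sqrt v) A.

(* C x^* y^* stands for the pairing of the covariance operator *)
Definition centred_gaussian (R : realType) (E : normedModType R)
    (C : (E -> R) -> (E -> R) -> R) (mu : probability (borel E) R) : Prop :=
  forall x : {scalar E}, continuous (x : E -> R) ->
    forall A : set R, measurable A ->
      pushforward mu (x : borel E -> R) A = centred_normal (C x x) A.

Section OrnsteinUhlenbeck.
Context {R : realType} {E : completeNormedModType R}.
Variables (S : R -> {linear E -> E}) (mu : R -> probability (borel E) R).

Definition OU (t : R) (f : E -> R) (x : E) : R :=
  \int[mu t]_(y in [set: borel E]) f (S t x + y).

Definition supnorm (f : E -> R) : R := sup (range (fun x => `|f x|)).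

Definition BUC : set (E -> R) :=
  [set f | [bounded f x | x in [set: E]] /\ unif_continuous f].

Definition BUCo : set (E -> R) :=
  [set f | BUC f /\ supnorm (OU t f \- f) @[t --> 0^'+] --> 0].

(* The norm, in L(X), of an operator T on the subspace X. *)
Definition opnorm (X : set (E -> R)) (T : (E -> R) -> (E -> R)) : R :=
  sup [set supnorm (T f) | f in [set f | X f /\ supnorm f <= 1]].

End OrnsteinUhlenbeck.

(* Main.v *)
(* Let f(x) = (1/l) * integral over [0, l] of phi(xi(S(r) x)) dr, where xi is a continuous
   linear functional and phi is Lipschitz with |phi| <= 1. Moving x along the flow for a
   time h only shifts the averaging window, so |f(S(h) x) - f(x)| <= 2h/l uniformly in x.
   By Tonelli, the Gaussian perturbation P(h)f(x) - f(S(h) x) only involves the laws under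
   mu_h of the functionals xi o S(r), which are centred normal with variance O(h); hence f
   lies in BUC^o without any use of the semigroup law of P.
   Choose x0 in D(A) and, by Hahn-Banach, xi with xi(A x0) > 0, so that t |-> xi(S(t) x0) is
   strictly increasing on some [0, t0]. For s < t in this interval let
   phi(u) = clamp((u/N - m)/rho) with m halfway between xi(S(s) x0) and xi(S(t) x0): then
   f(S(t) (N x0)) = 1 and f(S(s) (N x0)) = -1 for small l, while the Lipschitz constant of
   phi is O(1/N), so the Gaussian perturbation at N x0 vanishes as N grows. *)
Require Import Defs.
From HB Require Import structures.
From mathcomp Require Import all_boot all_order all_algebra.
From mathcomp Require Import all_classical all_reals all_analysis.
From mathcomp Require Import measurable_realfun.
From mathcomp Require Import ring lra.
Import Order.TTheory GRing.Theory Num.Theory.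
Import numFieldTopology.Exports numFieldNormedType.Exports.
Local Open Scope classical_set_scope.
Local Open Scope ring_scope.

(** * Hahn-Banach *)

Section HahnBanach.
Context {R : realType} {E : normedModType R}.
Implicit Types (G : set (E * R)) (x y z : E).

(** A linear functional of norm at most 1 on a subspace is encoded by its graph, so that extension
    becomes inclusion. The empty set also qualifies. *)
Definition dominated_graph G : Prop :=
  (forall a p q, G p -> G q -> G (a *: p.1 + q.1, a * p.2 + q.2)) /\
  (forall p, G p -> p.2 <= `|p.1|).

(** The points (0, r - s) and (0, s - r) both lie in [G], and domination bounds their second
    components by |0| = 0. *)
Lemma dominated_graph_unique G x r s :
  dominated_graph G -> G (x, r) -> G (x, s) -> r = s.
Proof.
move=> [linG domG] Gr Gs; apply/eqP; rewrite eq_le.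
have := domG _ (linG (-1) _ _ Gr Gs); have := domG _ (linG (-1) _ _ Gs Gr).
by rewrite /= !scaleN1r !addNr normr0 !mulN1r; lra.
Qed.

(** The value c at [z] must lie above every q.2 - |q.1 - z| and below every |p.1 + z| - p.2. The
    triangle inequality separates these two families, and the infimum of the upper one is taken.
    Rescaling by 1/|a| reduces domination at p.1 + a z to these two constraints. *)
Lemma dominated_graph_extend G z : dominated_graph G -> G !=set0 ->
  exists G', [/\ dominated_graph G', G `<=` G' & exists c, G' (z, c)].
Proof.
move=> [linG domG] [[x0 r0] G0].
have G00 : G (0, 0).
  by have := linG (-1) _ _ G0 G0; rewrite /= scaleN1r addNr mulN1r addNr.
pose U := [set `|p.1 + z| - p.2 | p in G].
have sep p q : G p -> G q -> q.2 - `|q.1 - z| <= `|p.1 + z| - p.2.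
  move=> Gp Gq; have := domG _ (linG 1 _ _ Gp Gq); rewrite /= scale1r mul1r.
  have := ler_normD (p.1 + z) (q.1 - z); rewrite addrACA subrr addr0; lra.
pose c := inf U.
have cle p : G p -> c <= `|p.1 + z| - p.2.
  move=> Gp; apply: ge_inf; last by exists p.
  by exists (0 - `|0 - z|) => _ [q Gq <-]; exact: (sep q (0, 0)).
have cge q : G q -> q.2 - `|q.1 - z| <= c.
  move=> Gq; apply: lb_le_inf; first by exists (`|0 + z| - 0), (0, 0).
  by move=> _ [p Gp <-]; exact: sep.
exists [set (p.1 + a *: z, p.2 + a * c) | p in G & a in [set: R]]; split.
- split.
  + move=> a _ _ [p Gp [b _ <-]] [q Gq [d _ <-]] /=.
    exists (a *: p.1 + q.1, a * p.2 + q.2); first exact: linG.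
    exists (a * b + d) => //=; congr pair; last by ring.
    by rewrite scalerDr scalerDl scalerA addrACA.
  + move=> _ [p Gp [a _ <-]] /=.
    have scG b : G (b *: p.1, b * p.2).
      by have := linG b _ _ Gp G00; rewrite /= !addr0.
    have [a0|a0|->] := ltgtP a 0; last by rewrite scale0r mul0r !addr0; exact: domG.
    * have na : 0 < - a by rewrite oppr_gt0.
      have := cge _ (scG (- a)^-1); rewrite /=.
      rewrite -(ler_pM2l na) mulrBr mulrA divff ?gt_eqF// mul1r.
      rewrite -[X in X * `|_|](gtr0_norm na) -normrZ scalerBr scalerA.
      by rewrite divff ?gt_eqF// scale1r scaleNr opprK; lra.
    * have := cle _ (scG a^-1); rewrite /=.
      rewrite -(ler_pM2l a0) mulrBr mulrA divff ?gt_eqF// mul1r.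
      rewrite -[X in X * `|_|](gtr0_norm a0) -normrZ scalerDr scalerA.
      by rewrite divff ?gt_eqF// scale1r; lra.
- by move=> [x r] Gx; exists (x, r) => //; exists 0; rewrite //= scale0r mul0r !addr0.
- by exists c; exists (0, 0) => //; exists 1; rewrite //= scale1r mul1r !add0r.
Qed.

Lemma dominated_graph_line y :
  dominated_graph [set p | exists a, p = (a *: y, a * `|y|)].
Proof.
split=> [a _ _ [b ->] [d ->]|_ [a ->]] /=.
  by exists (a * b + d); rewrite scalerDl scalerA mulrDl mulrA.
by rewrite normrZ ler_wpM2r// ler_norm.
Qed.

Lemma norming_functional y :
  exists xi : {scalar E}, (forall x, `|xi x| <= `|x|) /\ xi y = `|y|.
Proof.
(* The condition at [y] is imposed on nonempty graphs only, because the union of the empty chain is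
   empty and has to qualify. *)
have [G [[domG Gy] maxG]] : exists G, (dominated_graph G /\
    (G !=set0 -> G (y, `|y|))) /\
    forall G', G `<` G' -> ~ (dominated_graph G' /\ (G' !=set0 -> G' (y, `|y|))).
  apply: Zorn_bigcup => F FP totF; split; last first.
    by move=> [p [G FG Gp]]; exists G => //; apply: (FP _ FG).2; exists p.
  split=> [a p q [G FG Gp] [G' FG' G'q]|p [G FG Gp]]; last first.
    exact: (FP _ FG).1.2.
  have [GG'|G'G] := totF _ _ FG FG'.
    by exists G' => //; apply: (FP _ FG').1.1 => //; exact: GG'.
  by exists G => //; apply: (FP _ FG).1.1 => //; exact: G'G.
(* An empty [G] would not be maximal: the graph on the line through [y] strictly contains it. *)
have Gn0 : G !=set0.
  apply: contrapT => /set0P/negP; rewrite negbK => /eqP G0.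
  apply: (maxG [set p | exists a, p = (a *: y, a * `|y|)]).
    rewrite G0; split=> //.
    move=> line0; apply: (line0 (0, 0)); exists 0.
    by rewrite scale0r mul0r.
  split; first exact: dominated_graph_line.
  by move=> _; exists 1; rewrite scale1r mul1r.
have totG x : exists r, G (x, r).
  have [G' [dG' GG' [c G'c]]] := dominated_graph_extend _ x domG Gn0.
  apply: contrapT => nG; apply: (maxG G').
    by split => // G'G; apply: nG; exists c; exact: G'G.
  by split=> // _; exact/GG'/Gy.
pose f x := sval (cid (totG x)).
have Gf x : G (x, f x) by rewrite /f; case: cid.
have linf : linear_for *%R f.
  move=> a u v; apply: (dominated_graph_unique _ _ _ _ domG (Gf _)).
  exact: (domG.1 a _ _ (Gf u) (Gf v)).
pose xi : {scalar E} := HB.pack f (GRing.isLinear.Build _ _ _ _ f linf).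
exists xi; split=> [x|]; last exact: dominated_graph_unique domG (Gf y) (Gy Gn0).
rewrite ler_norml; apply/andP; split; last exact: (domG.2 _ (Gf x)).
have := domG.2 _ (Gf (- x)); rewrite /= normrN.
by have := linearN xi x; rewrite /= /xi/= => ->; lra.
Qed.

End HahnBanach.

(** * Semigroup orbits *)

Lemma near_right0P (R : realType) (P : R -> Prop) :
  (\forall t \near 0^'+, P t) -> exists2 d, 0 < d & forall t, 0 < t < d -> P t.
Proof.
case=> d /= d0 dP; exists d => // t /andP[t0 td]; apply: dP => //=.
by rewrite sub0r normrN gtr0_norm.
Qed.

Lemma continuous_linear_normP (R : realType) (V W : normedModType R)
    (f : {linear V -> W}) : continuous f ->
  exists2 K, 0 < K & forall x, `|f x| <= K * `|x|.
Proof.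
move=> /linear_bounded_continuous/linear_boundedP[K [_ KP]].
exists (`|K| + 1); first by rewrite ltr_wpDl.
by apply: KP; rewrite (le_lt_trans (ler_norm K))// ltrDl.
Qed.

Section Semigroup.
Context {R : realType} {E : completeNormedModType R}.
Variable S : R -> {linear E -> E}.
Hypothesis C0S : C0_semigroup S.

Lemma orbit_continuous0 x e : 0 < e ->
  exists2 d, 0 < d & forall h, 0 <= h < d -> `|S h x - x| <= e.
Proof.
case: C0S => _ S0 _ Scvg e0.
have /cvgrPdist_le/(_ _ e0)/near_right0P[d d0 dP] := Scvg x.
exists d => // h /andP[]; rewrite le_eqVlt => /predU1P[<- _|h0 hd].
  by rewrite S0 subrr normr0 ltW.
by rewrite distrC dP// h0.
Qed.

(** Otherwise there are times t n <= 1/(n+1) at which the norm of S (t n) exceeds n+1. Since S (t n)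
    x tends to x, these operators are pointwise bounded, which contradicts Banach-Steinhaus. *)
Lemma semigroup_locally_bounded : exists2 eta, 0 < eta &
  exists2 M, 0 < M & forall t x, 0 <= t <= eta -> `|S t x| <= M * `|x|.
Proof.
apply: contrapT => unb.
have {}unb n : exists t : R, 0 <= t <= n.+1%:R^-1 /\
    exists x, n.+1%:R * `|x| < `|S t x|.
  apply: contrapT => bnd; apply: unb; exists n.+1%:R^-1; first by rewrite invr_gt0.
  exists n.+1%:R => // t x tn; rewrite leNgt; apply/negP => Sx.
  by apply: bnd; exists t; split => //; exists x.
pose t n := sval (cid (unb n)).
have tP n : 0 <= t n <= n.+1%:R^-1 /\ exists x, n.+1%:R * `|x| < `|S (t n) x|.
  by rewrite /t; case: cid.
have cS n : continuous (S (t n)).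
  by case: C0S => + _ _ _; apply; have [/andP[]] := tP n.
have /(_ 1)[K KP] : uniform_bounded (range (fun n => S (t n) : E -> E)).
  apply: Banach_Steinhauss => [_ [n _ <-]|x].
    split; last exact: linearP.
    move=> r; have [K K0 KP] := continuous_linear_normP _ _ _ _ (cS n).
    by exists (K * r) => x xr; rewrite (le_trans (KP x))// ler_wpM2l// ltW.
  have [d d0 dP] := orbit_continuous0 x _ (@ltr01 R).
  pose N := Num.truncn d^-1.
  (* For n > N the time t n is below d, so |x| + 1 suffices; the sum covers the finitely many other
     indices. *)
  exists (`|x| + 1 + \sum_(k < N.+1) `|S (t k) x|) => _ [n _ <-].
  have [nN|Nn] := ltnP n N.+1.
    rewrite (bigD1 (Ordinal nN))//= addrCA lerDl !addr_ge0//.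
    by apply: sumr_ge0 => ? _; exact: normr_ge0.
  apply: le_trans (_ : `|x| + 1 <= _); last first.
    by rewrite lerDl; apply: sumr_ge0 => ? _; exact: normr_ge0.
  rewrite -lerBlDl; apply: le_trans (lerB_dist _ _) _; apply: dP.
  have [/andP[-> tn] _] := tP n.
  rewrite /= (le_lt_trans tn)// invf_plt ?posrE//.
  by rewrite (lt_le_trans (truncnS_gt _))// ler_nat ltnW.
have {}KP n x : `|S (t n) x| <= K * `|x|.
  have [->|x0] := eqVneq x 0; first by rewrite linear0 normr0 mulr0.
  have /= := KP (S (t n)) (ex_intro2 _ _ n Logic.I erefl) (`|x|^-1 *: x).
  rewrite normrZ normfV normr_id mulVf ?normr_eq0// lexx => /(_ isT).
  by rewrite linearZ normrZ normfV normr_id mulrC ler_pdivrMr ?normr_gt0.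
(* At this index the growth factor [(Num.truncn K).+1] exceeds [K]. *)
have [_ [x]] := tP (Num.truncn K).
apply/negP; rewrite -leNgt (le_trans (KP _ x))// ler_wpM2r//.
by rewrite ltW// truncnS_gt.
Qed.

(** Write S(r+h)x - S(r)x = h S(r)q with q the difference quotient at [x], so only the right
    derivative at time 0 enters. For small r and h the errors S(r)y - y and S(r)(y - q) each cost
    [xi] at most D/4, so the increment is at least h D/2. *)
Lemma functional_orbit_increasing (xi : {scalar E}) x :
  (forall z, `|xi z| <= `|z|) -> generator_domain S x -> 0 < xi (generator S x) ->
  exists2 t0, 0 < t0 &
    forall s t, 0 <= s -> s < t -> t <= t0 -> xi (S s x) < xi (S t x).
Proof.
move=> xi1 Dx; set y := generator S x; set D := xi y => D0.
have [eta eta0 [M M0 MP]] := semigroup_locally_bounded.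
have [t1 t10 t1P] : exists2 d, 0 < d &
    forall h, 0 <= h < d -> `|S h y - y| <= D / 4.
  by apply: orbit_continuous0; rewrite divr_gt0.
have [d d0 dP] : exists2 d, 0 < d &
    forall h, 0 < h < d -> `|y - diff_quotient S x h| <= D / 4 / M.
  apply: near_right0P; have /cvgrPdist_le : diff_quotient S x t @[t --> 0^'+] --> y.
    exact: Dx.
  by apply; rewrite !divr_gt0.
have incr r h : 0 <= r -> r <= eta -> r < t1 -> 0 < h < d ->
    xi (S r x) < xi (S (r + h) x).
  move=> r0 reta rt1 /[dup] hd /andP[h0 _].
  have [_ _ SD _] := C0S; rewrite SD ?(ltW h0)//.
  have := dP _ hd; have -> : S h x = x + h *: diff_quotient S x h.
    by rewrite scalerA divff ?gt_eqF// scale1r addrCA subrr addr0.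
  move: (diff_quotient S x h) => q yq.
  rewrite !linearD/= !linearZ/= ltrDl pmulr_rgt0//.
  have -> : q = y - (y - q) by rewrite subKr.
  have -> : S r (y - (y - q)) = (S r y - y) + y - S r (y - q).
    by rewrite linearB subrK.
  rewrite linearB linearD /= -/D.
  have /ler_normlP[_ ]:= xi1 (S r (y - q)).
  have : `|xi (S r y - y)| <= D / 4.
    by rewrite (le_trans (xi1 _))// t1P// r0.
  move=> /ler_normlP[+ _].
  have : `|S r (y - q)| <= D / 4.
    rewrite (le_trans (MP _ _ _)) ?r0//.
    by rewrite mulrC -ler_pdivlMr.
  by move: D0; lra.
exists (Num.min eta (t1 / 2)); first by rewrite lt_min eta0 divr_gt0.
move=> s t s0 st; rewrite le_min => /andP[teta tt1].
(* The estimate [incr] only covers steps shorter than d, so [s, t] is cut into N+1 equal steps. *)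
pose N := Num.truncn ((t - s) / d); pose h := (t - s) / N.+1%:R.
have ts0 : 0 < t - s by rewrite subr_gt0.
have h0 : 0 < h by rewrite divr_gt0.
have hd : h < d.
  by rewrite ltr_pdivrMr// mulrC -ltr_pdivrMr// truncnS_gt.
have NhE : N.+1%:R * h = t - s by rewrite mulrC divfK.
suff /(_ N.+1 (leqnn _) isT) : forall k, (k <= N.+1)%N -> (0 < k)%N ->
    xi (S s x) < xi (S (s + k%:R * h) x) by rewrite NhE addrC subrK.
elim=> [//|k IH] kN _; have kh0 : 0 <= k%:R * h by rewrite mulr_ge0// ltW.
have kh : k%:R * h <= t - s by rewrite -NhE ler_wpM2r ?(ltW h0)// ler_nat ltnW.
(* Only a weak inequality is available up to the k-th point, since for k = 0 that point is s
   itself. *)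
apply: (@le_lt_trans _ _ (xi (S (s + k%:R * h) x))).
  case: k IH kN {kh0 kh} => [|k] IH kN; first by rewrite mul0r addr0.
  by apply: ltW; apply: IH => //; exact: ltnW.
rewrite -natr1 mulrDl mul1r addrA; apply: incr; rewrite ?h0//.
- exact: addr_ge0.
- by rewrite (le_trans _ teta)// -lerBrDl.
- by move: t10; lra.
Qed.

End Semigroup.

(** * Gaussian tails and covariances *)

(* [ge0_le_integral] asks for measurable integrands, which is not known a priori
   for the integrand of [Qt_pairing]. *)
Lemma ge0_le_integral_cst d (T : measurableType d) (R : realType)
    (nu : {measure set T -> \bar R}) (D : set T) (f : T -> R) (c : R) :
  measurable D -> (forall x, D x -> 0 <= f x <= c) ->
  (\int[nu]_(x in D) (f x)%:E <= c%:E * nu D)%E.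
Proof.
move=> mD fc; rewrite -integral_cst//.
rewrite ge0_integralE; last by move=> x /fc/andP[].
rewrite ge0_integralE; last first.
  by move=> x /fc/andP[f0 ?]; rewrite lee_fin (le_trans f0).
(* Both integrals are suprema over simple functions below the integrand, and those below f on D are
   below c there. *)
apply: ge_ereal_sup => _ [h /= hf <-]; apply: ereal_sup_ubound; exists h => //= x.
apply: le_trans (hf x) _; rewrite !patchE; case: ifPn => // xD.
by rewrite lee_fin; have /andP[] := fc _ (set_mem xD).
Qed.

(** With w = u^2 / (8 s^2) the ratio of the two densities is 2 exp(-3w), and exp(3w) >= 1 + 3w.
    Comparison with the normal law of doubled deviation replaces a second moment by a total mass in
    the tail bound. *)
Lemma normal_pdf_tail (R : realType) (s a u : R) : 0 < s -> 0 < a -> a <= `|u| ->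
  normal_pdf 0 s u <= 6 * s ^+ 2 / a ^+ 2 * normal_pdf 0 (2 * s) u.
Proof.
move=> s0 a0 au; have s20 : 0 < 2 * s by rewrite mulr_gt0.
rewrite !normal_pdfE ?gt_eqF//.
have -> : normal_peak s = 2 * normal_peak (2 * s).
  rewrite /normal_peak (_ : (2 * s) ^+ 2 * pi *+ 2 = 2 ^+ 2 * (s ^+ 2 * pi *+ 2)); last first.
    by rewrite exprMn -!mulrnAr !mulrA.
  by rewrite sqrtrM ?sqr_ge0// sqrtr_sqr ger0_norm// invfM mulrA divff ?mul1r// gt_eqF.
rewrite -mulrA mulrCA [leRHS]mulrCA ler_wpM2l ?normal_peak_ge0//.
rewrite /normal_fun !subr0.
set w := u ^+ 2 / (8 * s ^+ 2).
have -> : - u ^+ 2 / (s ^+ 2 *+ 2) = - (3 * w) - w by rewrite /w; field; rewrite gt_eqF.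
have -> : - u ^+ 2 / ((2 * s) ^+ 2 *+ 2) = - w by rewrite /w; field; rewrite gt_eqF.
rewrite expRD mulrA ler_wpM2r ?expR_ge0// expRN.
have a2u : a ^+ 2 <= u ^+ 2.
  by rewrite -[u ^+ 2]real_normK ?num_real// ler_sqr ?nnegrE// ltW.
rewrite ler_pdivrMr ?expR_gt0// mulrAC ler_pdivlMr ?exprn_gt0//.
apply: le_trans (_ : 6 * s ^+ 2 * (1 + 3 * w) <= _); last first.
  by rewrite ler_wpM2l ?expR_ge1Dx// mulr_ge0// sqr_ge0.
have -> : 6 * s ^+ 2 * (1 + 3 * w) = 6 * s ^+ 2 + 9 / 4 * u ^+ 2.
  by rewrite /w; field; rewrite gt_eqF.
by have := sqr_ge0 s; have := sqr_ge0 u; lra.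
Qed.

(** A Chebyshev inequality with constant 6: integrate [normal_pdf_tail] and bound the mass of the
    wider normal law by 1. For v = 0 the Dirac mass at 0 misses the set. *)
Lemma centred_normal_tail (R : realType) (v a : R) : 0 <= v -> 0 < a ->
  (centred_normal v [set u : R | (a <= `|u|)%R] <= (6 * v / a ^+ 2)%:E)%E.
Proof.
move=> v0 a0; have mA : measurable [set u : R | a <= `|u|].
  by rewrite -[X in measurable X]setTI; apply: measurable_fun_le.
rewrite /centred_normal; have [->|vn0] := eqVneq v 0.
  by rewrite diracE mulr0 mul0r memNset//= normr0 leNgt a0.
have s0 : 0 < Num.sqrt v by rewrite sqrtr_gt0 lt_neqAle eq_sym vn0.
set c := 6 * v / a ^+ 2; have c0 : 0 <= c by rewrite divr_ge0 ?sqr_ge0// mulr_ge0.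
apply: (@le_trans _ _ (\int[lebesgue_measure]_(x in [set u : R | (a <= `|u|)%R])
    (c%:E * (normal_pdf 0 (2 * Num.sqrt v) x)%:E))%E).
  apply: ge0_le_integral => //.
  - by move=> x _; rewrite lee_fin normal_pdf_ge0.
  - by apply/measurable_EFinP; apply: measurable_funTS; exact: measurable_normal_pdf.
  - apply: measurable_funeM; apply/measurable_EFinP; apply: measurable_funTS.
    exact: measurable_normal_pdf.
  - move=> x ax; rewrite -EFinM lee_fin (le_trans (normal_pdf_tail _ _ _ _ s0 a0 ax))//.
    by rewrite sqr_sqrtr.
rewrite ge0_integralZl//; last 2 first.
- by apply/measurable_EFinP; apply: measurable_funTS; exact: measurable_normal_pdf.
- by move=> x _; rewrite lee_fin normal_pdf_ge0.
rewrite -[leRHS]mule1 lee_wpmul2l ?lee_fin//.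
exact: (@probability_le1 _ _ _ (normal_prob 0 (2 * Num.sqrt v))).
Qed.

Section Covariance.
Context {R : realType} {E H : completeNormedModType R}.
Variables (ip : H -> H -> R) (S : R -> {linear E -> E}) (B : {linear H -> E}).
Hypothesis ipP : inner_product ip.

(* Whether or not the Riesz representative of [x \o S s \o B] exists, the integrand
   equals the square of the norm of [adjoint B (x \o S s)], which the bound on [x \o S s]
   controls. *)
Lemma Qt_pairing_bound (x : {scalar E}) (b K t : R) : 0 <= t ->
  (forall k, `|B k| <= b * `|k|) ->
  (forall s y, 0 <= s <= t -> `|x (S s y)| <= K * `|y|) -> 0 <= K ->
  0 <= Qt_pairing ip S B t x x <= (K * b) ^+ 2 * t.
Proof.
move=> t0 Bb SK K0.
have bnd s : [set` `[0, t]] s -> 0 <= x (S s (Q ip B (x \o S s))) <= (K * b) ^+ 2.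
  rewrite /= in_itv/= => st; rewrite /Q /adjoint.
  set P := [set h | _]; case: (pselect (exists h, P h)) => [[h0 Ph0]|nP]; last first.
    rewrite xgetPN; last by move=> h Ph; apply: nP; exists h.
    by rewrite !linear0 lexx sqr_ge0.
  (* Testing the representing identity at the representative h itself gives |h|^2 = x(S(s)Bh) <= K b
     |h|, whence |h| <= K b. *)
  have /(_ (xget 0 P)) hP := xgetPex 0 (ex_intro P h0 Ph0).
  have [_ _ ipn] := ipP.
  move: (xget 0 P) hP => h; rewrite ipn /= => hE; rewrite -hE sqr_ge0/=.
  have hK : `|h| ^+ 2 <= K * b * `|h|.
    rewrite hE (le_trans (ler_norm _))// (le_trans (SK _ _ st))//.
    by rewrite -mulrA ler_wpM2l.
  have [->|hn0] := eqVneq h 0; first by rewrite normr0 expr0n sqr_ge0.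
  have h0' : 0 < `|h| by rewrite normr_gt0.
  have hb : `|h| <= K * b by rewrite -(ler_pM2r h0') -expr2.
  by rewrite ler_sqr// nnegrE// (le_trans _ hb).
rewrite /Qt_pairing Rintegral_ge0/=; last by move=> s /bnd/andP[].
have := ge0_le_integral_cst _ _ _ lebesgue_measure _ _ _ (measurable_itv `[0, t]) bnd.
rewrite /= lebesgue_measure_itv/= lte_fin oppr0 adde0.
have -> : (if 0 < t then t%:E else 0%E) = t%:E by case: ltgtP t0 => // <-.
rewrite -EFinM => le_int; rewrite -lee_fin fineK//.
rewrite ge0_fin_numE ?(le_lt_trans le_int) ?ltry//.
by apply: integral_ge0 => s /bnd/andP[].
Qed.
End Covariance.

(** * Measurability and translation *)

Lemma lebesgue_measure_shift (R : realType) (h : R) (A : set (measurableTypeR R)) :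
  measurable A ->
  lebesgue_measure A = pushforward lebesgue_measure (fun x : measurableTypeR R => x + h) A.
Proof.
have mshift : @measurable_fun _ _ (measurableTypeR R) (measurableTypeR R)
  setT (fun x => x + h).
  exact: measurable_funD.
pose m2 : {measure set (measurableTypeR R) -> \bar R} :=
  measure_function_pushforward__canonical__measure_function_Measure lebesgue_measure mshift.
move=> mA; apply: (lebesgue_measure_unique (mu := m2)) => // _ [[a b] _ <-].
rewrite /m2/= /pushforward.
have -> : (fun x => x + h) @^-1` `]a, b] = `]a - h, b - h]%classic.
  by apply/seteqP; split=> x; rewrite /= !in_itv/= ltrBlDr lerBrDr.
rewrite !lebesgue_measure_itv/= !lte_fin ltrD2r.
by case: ifP => // _; rewrite -!EFinB opprB addrA subrK.
Qed.

Lemma bounded_integrable d (T : measurableType d) (R : realType)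
    (nu : {measure set T -> \bar R}) (D : set T) (f : T -> R) (c : R) :
  measurable D -> (nu D < +oo)%E -> measurable_fun D f ->
  (forall x, D x -> `|f x| <= c) -> nu.-integrable D (EFin \o f).
Proof.
move=> mD nuD mf fc; apply: measurable_bounded_integrable => //.
exists c; split; first exact: num_real.
by move=> c' cc' x Dx; apply: le_trans (fc _ Dx) (ltW cc').
Qed.

Lemma normr_Rintegral_le d (T : measurableType d) (R : realType)
    (nu : {measure set T -> \bar R}) (D : set T) (f : T -> R) (c : R) :
  measurable D -> (nu D < +oo)%E -> measurable_fun D f ->
  (forall x, D x -> `|f x| <= c) ->
  `|\int[nu]_(x in D) f x| <= c * fine (nu D).
Proof.
move=> mD nuD mf fc; rewrite -Rintegral_cst//.
have intf := bounded_integrable _ _ _ _ _ _ _ mD nuD mf fc.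
apply: (le_trans (le_normr_Rintegral mD intf)); apply: le_Rintegral => //.
  exact: (integrable_norm intf).
by apply: (bounded_integrable _ _ _ _ _ _ `|c|).
Qed.

Lemma Rintegral_shift (R : realType) (G : R -> R) (c a b h : R) :
  measurable_fun [set: measurableTypeR R] G -> (forall r, `|G r| <= c) ->
  \int[lebesgue_measure]_(r in `[a, b]) G (r + h) =
  \int[lebesgue_measure]_(r in `[a + h, b + h]) G r.
Proof.
move=> mG Gc; rewrite /Rintegral; congr fine.
have mshift : @measurable_fun _ _ (measurableTypeR R) (measurableTypeR R)
    setT (fun x => x + h) by exact: measurable_funD.
pose m2 : {measure set (measurableTypeR R) -> \bar R} :=
  measure_function_pushforward__canonical__measure_function_Measure lebesgue_measure mshift.
rewrite (@eq_measure_integral _ (measurableTypeR R) _ [set` `[a + h, b + h]] m2)/=; last first.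
  by move=> A mA _; exact: lebesgue_measure_shift.
have preE : (fun x => x + h) @^-1` `[a + h, b + h] = `[a, b]%classic.
  by apply/seteqP; split=> x; rewrite /= !in_itv/= !lerD2r.
rewrite (integral_pushforward mshift) ?preE//.
  exact/measurable_EFinP.
apply: (bounded_integrable _ _ _ _ _ (fun r : measurableTypeR R => G (r + h)) c) => //.
  by rewrite /= lebesgue_measure_itv/=; case: ifP => // _; rewrite ltry.
apply: measurable_funTS; exact: (measurableT_comp mG).
Qed.

(** Comparing both windows with [0, l + h] leaves the integral over ]l, l + h] minus that over
    [0, h], each of length h. This also covers windows that do not overlap. *)
Lemma Rintegral_shift_dist (R : realType) (G : R -> R) (c l h : R) :
  measurable_fun [set: measurableTypeR R] G -> (forall r, `|G r| <= c) ->
  0 <= l -> 0 <= h ->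
  `|\int[lebesgue_measure]_(r in `[0, l]) G (r + h) -
    \int[lebesgue_measure]_(r in `[0, l]) G r| <= 2 * c * h.
Proof.
move=> mG Gc l0 h0; rewrite (Rintegral_shift _ _ _ _ _ _ mG Gc) add0r.
have muI (i j : itv_bound R) :  -oo%O != i -> j != +oo%O ->
    (lebesgue_measure [set` Interval i j] < +oo)%E.
  by rewrite lebesgue_measure_itv/=; case: ifP; case: i j => [? ?|[]] [? ?|[]]//= *; rewrite ltry.
have iG (i j : itv_bound R) : -oo%O != i -> j != +oo%O ->
    lebesgue_measure.-integrable [set` Interval i j] (EFin \o G).
  move=> io jo; apply: (bounded_integrable _ _ _ _ _ _ c) => //; first exact: muI.
  exact: measurable_funTS.
rewrite -[X in `|X - _|]Rintegral_itv_obnd_cbnd; last exact: iG.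
rewrite -(@Rintegral_itvB _ _ (BLeft 0)) ?bnd_simp//; [|exact: iG|by rewrite lerDr].
rewrite addrAC Rintegral_itvB ?bnd_simp//; [|exact: iG|by rewrite lerDl].
rewrite (le_trans (ler_normB _ _))// -[2 * c]mulrC mulrAC mulr_natr mulr2n.
have bnd (i j : itv_bound R) : -oo%O != i -> j != +oo%O ->
    lebesgue_measure [set` Interval i j] = h%:E ->
    `|\int[lebesgue_measure]_(r in [set` Interval i j]) G r| <= c * h.
  move=> io jo mh; rewrite -[h]/(fine h%:E) -mh normr_Rintegral_le//.
  - exact: muI.
  - exact: measurable_funTS.
have hE : (if 0 < h then h%:E else 0%E) = h%:E by case: ltgtP h0 => // <-.
rewrite lerD// bnd// lebesgue_measure_itv/= lte_fin.
  by rewrite ltrDl -EFinB addrAC subrr add0r.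
by rewrite oppr0 adde0.
Qed.


(** Supplies the joint measurability for Tonelli. Rounding r up to a grid of mesh 1/(n+1) gives
    functions whose preimages are countable unions of rectangles, and right continuity gives the
    limit. *)
Lemma measurable_right_continuous d (T : measurableType d) (R : realType)
    (F : R -> T -> R) :
  (forall r, measurable_fun [set: T] (F r)) ->
  (forall y r, F t y @[t --> r^'+] --> F r y) ->
  measurable_fun [set: (measurableTypeR R * T)%type] (fun p => F p.1 p.2).
Proof.
move=> mF cF.
(* Floor plus one rather than ceiling: the approximations stay strictly above r, as a limit along
   [r^'+] demands. *)
pose up (n : nat) (r : R) : R := (Num.floor (r * n.+1%:R) + 1)%:~R / n.+1%:R.
apply: (@measurable_fun_cvg _ _ R setT (fun n p => F (up n p.1) p.2)) => [n|[r y] _ /=]; last first.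
  have /cvg_at_rightP := cF y r; apply; split=> [n|].
    by rewrite /up ltr_pdivlMr// floorD1_gt.
  apply: (@squeeze_cvgr _ _ _ _ (cst r) (fun n => r + n.+1%:R^-1)); last 2 first.
  - exact: cvg_cst.
  - by rewrite -[X in _ --> X]addr0; apply: cvgD; [exact: cvg_cst|exact: cvg_harmonic].
  apply: nearW => n; rewrite /up /= ler_pdivlMr// ltW ?floorD1_gt//=.
  rewrite ler_pdivrMr// mulrDl mulVf ?pnatr_eq0// intrD lerD2r.
  exact: floor_le.
move=> _ A mA; rewrite setTI.
have -> : (fun p => F (up n p.1) p.2) @^-1` A = \bigcup_(z : int)
    ([set` `[z%:~R / n.+1%:R, (z + 1)%:~R / n.+1%:R[] `*`
     (F ((z + 1)%:~R / n.+1%:R) @^-1` A)).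
  apply/seteqP; split=> [[r y] /= Ary|[r y] [z _ [/=]]].
    exists (Num.floor (r * n.+1%:R)) => //; split=> //=.
    by rewrite in_itv/= ler_pdivrMr// ltr_pdivlMr// floor_itv.
  rewrite in_itv/= ler_pdivrMr// ltr_pdivlMr// => /floor_def zE.
  by rewrite /up zE.
apply: countable_bigcupT_measurable => // z.
apply: measurableX => //; rewrite -[X in measurable X]setTI; exact: mF.
Qed.

(** * Orbit averages *)

Lemma lipschitz_unif_continuous (R : realType) (V W : normedModType R)
    (f : V -> W) (K : R) : 0 <= K ->
  (forall x y, `|f x - f y| <= K * `|x - y|) -> unif_continuous f.
Proof.
move=> K0 fK; apply/unif_continuousP => e e0.
have K1 : 0 < K + 1 by rewrite ltr_wpDl.
exists (e / (K + 1)); first exact: divr_gt0.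
move=> [x y]; rewrite -!ball_normE /= ltr_pdivlMr// => xy.
rewrite (le_lt_trans (fK _ _))// (le_lt_trans _ xy)// mulrC ler_wpM2l//.
by rewrite lerDl.
Qed.

Lemma unif_continuous_continuous (R : realType) (V W : normedModType R)
    (f : V -> W) : unif_continuous f -> continuous f.
Proof.
move=> /unif_continuousP fu x; apply/cvgrPdist_lt => e e0.
have [d d0 dP] := fu e e0; apply/nbhs_ballP; exists d => //= y xy.
by have := dP (x, y) xy; rewrite -ball_normE.
Qed.

Lemma continuous_borel_measurable (R : realType) (E : normedModType R) (f : E -> R) :
  continuous f -> measurable_fun [set: borel E] (f : borel E -> R).
Proof.
move=> cf; apply: (measurability _ (RGenOInfty.measurableE R)) => _ [_ [a ->] <-].
rewrite setTI; apply: sub_sigma_algebra.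
by apply: open_comp => [x _|]; [exact: cf|exact: interval_open].
Qed.

Section OrbitAverage.
Context {R : realType} {E : completeNormedModType R}.
Variables (S : R -> {linear E -> E}) (xi : {scalar E}) (phi : R -> R) (L : R).
Hypothesis C0S : C0_semigroup S.
Hypothesis xi1 : forall z, `|xi z| <= `|z|.
Hypothesis L0 : 0 <= L.
Hypothesis phi1 : forall u, `|phi u| <= 1.
Hypothesis phiL : forall u v, `|phi u - phi v| <= L * `|u - v|.

(* The truncation makes [orbit_value r x] right-continuous in every real [r]. *)
Definition orbit_value (r : R) (x : E) : R := phi (xi (S (Num.max 0 r) x)).

Lemma orbit_value_dist r x y :
  `|orbit_value r x - orbit_value r y| <= L * `|xi (S (Num.max 0 r) (x - y))|.
Proof. by rewrite (le_trans (phiL _ _))// !linearB. Qed.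

Lemma semigroup_max_normP r : exists2 K, 0 < K & forall x, `|S (Num.max 0 r) x| <= K * `|x|.
Proof.
by apply: continuous_linear_normP; case: C0S => + _ _ _; apply; rewrite le_max lexx.
Qed.

Lemma orbit_value_continuous r : continuous (orbit_value r).
Proof.
have [K K0 KP] := semigroup_max_normP r.
apply: unif_continuous_continuous.
apply: (@lipschitz_unif_continuous _ _ _ _ (L * K)) => [|y z].
  by rewrite mulr_ge0// ltW.
rewrite (le_trans (orbit_value_dist _ _ _))// -mulrA ler_wpM2l//.
by rewrite (le_trans (xi1 _)).
Qed.

(** For t > r >= 0, S(t)x - S(r)x = S(r)(S(t-r)x - x), so continuity at time 0 and boundedness of
    the single operator S(r) suffice. For r < 0 the truncation makes the function constant to the
    right of r. *)
Lemma orbit_value_right_continuous x r :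
  orbit_value t x @[t --> r^'+] --> orbit_value r x.
Proof.
have [r0|r0] := ltP r 0.
  apply: (@cvg_trans _ (cst (orbit_value r x) t @[t --> r^'+])); last exact: cvg_cst.
  apply: near_eq_cvg; near=> t.
  have t0 : t <= 0 by near: t; exact: nbhs_right_ltW.
  by rewrite /orbit_value !max_l// ltW.
have [K K0 KP] := semigroup_max_normP r.
apply/cvgrPdist_le => e e0.
have [d d0 dP] : exists2 d, 0 < d & forall h, 0 <= h < d -> `|S h x - x| <= e / (L + 1) / K.
  by apply: orbit_continuous0 => //; rewrite !divr_gt0// ltr_wpDl.
near=> t.
have rt : r < t by near: t; exact: nbhs_right_gt.
have td : t - r < d by near: t; exact: nbhs_right_ltDr.
move: KP; rewrite distrC /orbit_value !max_r// ?(le_trans r0 (ltW rt))// => KP.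
have -> : S t x = S r (S (t - r) x).
  case: C0S => _ _ <- //; first by rewrite addrC subrK.
  by rewrite subr_ge0 ltW.
rewrite (le_trans (phiL _ _))// -!linearB (le_trans (ler_wpM2l L0 (xi1 _)))//.
rewrite (le_trans (ler_wpM2l L0 (KP _)))//.
have := dP (t - r); rewrite subr_ge0 ltW//= => /(_ td).
rewrite ler_pdivlMr// mulrC ler_pdivlMr ?ltr_wpDl// => le_e.
apply: le_trans le_e; rewrite [leRHS]mulrC; apply: ler_wpM2r; rewrite ?lerDl//.
by rewrite mulr_ge0// ltW.
Unshelve. all: by end_near. Qed.

Lemma orbit_value_measurable2 z : measurable_fun
  [set: (measurableTypeR R * borel E)%type] (fun p => orbit_value p.1 (z + p.2)).
Proof.
apply: (@measurable_right_continuous _ (borel E) _ (fun r y => orbit_value r (z + y))).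
  move=> r; apply: continuous_borel_measurable => y.
  apply: continuous_comp; last exact: orbit_value_continuous.
  by apply: cvgD; [exact: cvg_cst|exact: cvg_id].
by move=> y r; exact: orbit_value_right_continuous.
Qed.

Lemma orbit_value_measurable x :
  measurable_fun [set: measurableTypeR R] (orbit_value^~ x).
Proof.
have := @measurable_fun_pair1 _ _ _ (measurableTypeR R) (borel E) _ _ (0 : E)
  (orbit_value_measurable2 x).
by apply: eq_measurable_fun => r _; rewrite /= addr0.
Qed.

Variable l : R.
Hypothesis l0 : 0 < l.

Definition orbit_average (x : E) : R :=
  l^-1 * \int[lebesgue_measure]_(r in `[0, l]) orbit_value r x.

Lemma lebesgue_measure_0l : lebesgue_measure [set` `[0, l]] = l%:E :> \bar R.
Proof. by rewrite lebesgue_measure_itv/= lte_fin l0 oppr0 adde0. Qed.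

Lemma orbit_value_integrable x :
  lebesgue_measure.-integrable [set` `[0, l]] (EFin \o orbit_value^~ x).
Proof.
apply: (bounded_integrable _ _ _ _ _ _ 1) => //.
- by rewrite /= lebesgue_measure_0l ltry.
- by apply: measurable_funTS; exact: orbit_value_measurable.
- by move=> r _; exact: phi1.
Qed.

Lemma average_le (f : R -> R) c : measurable_fun [set: measurableTypeR R] f ->
  (forall r, 0 <= r <= l -> `|f r| <= c) ->
  `|l^-1 * \int[lebesgue_measure]_(r in `[0, l]) f r| <= c.
Proof.
move=> mf fc; rewrite normrM gtr0_norm ?invr_gt0// ler_pdivrMl// mulrC.
have := @normr_Rintegral_le _ _ _ lebesgue_measure [set` `[0, l]] f c.
rewrite /= lebesgue_measure_0l; apply.
- exact: measurable_itv.
- exact: ltry.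
- exact: measurable_funTS.
- by move=> r; rewrite /= in_itv/=; exact: fc.
Qed.

Lemma orbit_average_bound x : `|orbit_average x| <= 1.
Proof.
by apply: average_le => [|r _]; [exact: orbit_value_measurable|exact: phi1].
Qed.

Lemma orbit_averageB x y : orbit_average x - orbit_average y =
  l^-1 * \int[lebesgue_measure]_(r in `[0, l]) (orbit_value r x - orbit_value r y).
Proof.
by rewrite /orbit_average -mulrBr RintegralB//; exact: orbit_value_integrable.
Qed.

Lemma orbit_average_eq x k : (forall r, 0 <= r <= l -> orbit_value r x = k) ->
  orbit_average x = k.
Proof.
move=> ovk; rewrite /orbit_average (@eq_Rintegral _ _ _ _ _ (cst k)).
  rewrite Rintegral_cst//= lebesgue_measure_0l /= mulrCA mulVf ?mulr1//.
  by rewrite gt_eqF.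
by move=> r; rewrite inE/= in_itv/=; exact: ovk.
Qed.

Lemma orbit_average_lipschitz M : 0 <= M ->
  (forall t z, 0 <= t <= l -> `|S t z| <= M * `|z|) ->
  forall x y, `|orbit_average x - orbit_average y| <= L * M * `|x - y|.
Proof.
move=> M0 MP x y; rewrite orbit_averageB; apply: average_le => [|r rl].
  by apply: measurable_funB; exact: orbit_value_measurable.
rewrite (le_trans (orbit_value_dist _ _ _))// -mulrA ler_wpM2l//.
by rewrite (le_trans (xi1 _))// MP// max_r//; case/andP: rl.
Qed.

(* Following the flow for a time [h] only moves the averaging window by [h]. *)
Lemma orbit_average_flow h x : 0 <= h ->
  `|orbit_average (S h x) - orbit_average x| <= 2 * h / l.
Proof.
move=> h0; rewrite /orbit_average -mulrBr normrM gtr0_norm ?invr_gt0// mulrC.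
rewrite ler_pM2r ?invr_gt0//.
have := Rintegral_shift_dist _ _ _ _ _ (orbit_value_measurable x) (fun r => phi1 _) (ltW l0) h0.
rewrite mulr1; apply: le_trans.
rewrite le_eqVlt; apply/orP; left; apply/eqP; congr (`|_ - _|).
apply: eq_Rintegral => r; rewrite inE/= in_itv/= => /andP[r0 _].
rewrite /orbit_value !max_r ?addr_ge0//.
by case: C0S => _ _ ->.
Qed.

(** Tonelli exchanges the average over r with the integral over [nu], so a bound uniform in r passes
    to the average. The Lipschitz constant c serves the Borel measurability of the average. *)
Lemma orbit_average_convolution (nu : probability (borel E) R) z c b :
  0 <= c -> (forall x y, `|orbit_average x - orbit_average y| <= c * `|x - y|) ->
  (forall r, 0 <= r <= l ->
    (\int[nu]_y `|orbit_value r (z + y) - orbit_value r z|%:E <= b%:E)%E) ->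
  `|\int[nu]_(y in [set: borel E]) orbit_average (z + y) - orbit_average z| <= b.
Proof.
move=> c0 avgL int_le.
have mavg : measurable_fun [set: borel E] (fun y => orbit_average (z + y)).
  apply: continuous_borel_measurable; apply: unif_continuous_continuous.
  apply: (@lipschitz_unif_continuous _ _ _ _ c) => // x y.
  by rewrite (le_trans (avgL _ _))// [z + x]addrC addrKA.
have nuT : (nu [set: borel E] < +oo)%E by rewrite probability_setT ltry.
have -> : \int[nu]_(y in [set: borel E]) orbit_average (z + y) - orbit_average z =
    \int[nu]_(y in [set: borel E]) (orbit_average (z + y) - orbit_average z).
  rewrite RintegralB//.
  - by rewrite Rintegral_cst//= probability_setT /= mulr1.
  - by apply: (bounded_integrable _ _ _ _ _ _ 1) => // y _; exact: orbit_average_bound.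
  - by apply: (bounded_integrable _ _ _ _ _ _ 1) => // y _; exact: orbit_average_bound.
have mD : measurable_fun [set: borel E] (fun y => orbit_average (z + y) - orbit_average z).
  exact: measurable_funB.
have iD : nu.-integrable [set: borel E]
    (EFin \o (fun y => orbit_average (z + y) - orbit_average z)).
  apply: (bounded_integrable _ _ _ _ _ _ 2) => // y _.
  rewrite (le_trans (ler_normB _ _))// -[2]/(1 + 1).
  by rewrite lerD// orbit_average_bound.
apply: (le_trans (le_normr_Rintegral measurableT iD)).
pose D r y := `|orbit_value r (z + y) - orbit_value r z|.
(* The indicator carries the window, so that Tonelli applies on the whole product. *)
pose K (p : (measurableTypeR R * borel E)%type) : \bar R :=
  (D p.1 p.2 * \1_[set` `[0, l]] p.1)%:E.
have K0 p : (0 <= K p)%E by rewrite /K /D lee_fin mulr_ge0// indicE.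
have iov y : lebesgue_measure.-integrable [set` `[0, l]]
    (EFin \o (fun r => orbit_value r (z + y) - orbit_value r z)).
  apply: (bounded_integrable _ _ _ _ _
      (fun r : measurableTypeR R => orbit_value r (z + y) - orbit_value r z) 2) => //.
  - by rewrite /= lebesgue_measure_0l ltry.
  - by apply: measurable_funTS; apply: measurable_funB; exact: orbit_value_measurable.
  - by move=> r _; rewrite (le_trans (ler_normB _ _))// -[2]/(1 + 1) lerD ?phi1.
have iDy y : lebesgue_measure.-integrable [set` `[0, l]] (EFin \o D^~ y).
  exact: (integrable_norm (iov y)).
have mK : measurable_fun setT K.
  apply/measurable_EFinP; apply: measurable_funM; last first.
    by apply: measurableT_comp; [exact: measurable_indic|exact: measurable_fst].
  apply: measurableT_comp => //; apply: measurable_funB.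
    exact: orbit_value_measurable2.
  exact: (measurableT_comp (orbit_value_measurable z) measurable_fst).
have b0 : 0 <= b.
  rewrite -lee_fin (le_trans _ (int_le 0 _))//; last by rewrite lexx ltW.
  by apply: integral_ge0 => y _; rewrite lee_fin.
suff le_b : (\int[nu]_y `|orbit_average (z + y) - orbit_average z|%:E <= b%:E)%E.
  rewrite -lee_fin /Rintegral fineK// ge0_fin_numE ?(le_lt_trans le_b) ?ltry//.
  by apply: integral_ge0 => y _; rewrite lee_fin.
apply: (@le_trans _ _ (\int[nu]_y ((l^-1)%:E * \int[lebesgue_measure]_r K (r, y)))%E).
  apply: ge0_le_integral => //.
  - by apply/measurable_EFinP; exact: measurableT_comp.
  - apply: measurable_funeM.
    exact: (@measurable_fun_fubini_tonelli_G _ _ _ _ _ lebesgue_measure K mK K0).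
  - move=> y _.
    have -> : (\int[lebesgue_measure]_r K (r, y) =
        (\int[lebesgue_measure]_(r in `[0%R, l]) D r y)%:E)%E.
      rewrite /Rintegral fineK; last first.
        by apply: integrable_fin_num => //; exact: iDy.
      rewrite [RHS]integral_mkcond; apply: eq_integral => r _.
      rewrite /K patchE indicE /=; case: ifPn => _; first by rewrite mulr1.
      by rewrite mulr0.
    rewrite -EFinM lee_fin orbit_averageB normrM gtr0_norm ?invr_gt0//.
    rewrite ler_pM2l ?invr_gt0//; apply: le_normr_Rintegral => //.
rewrite ge0_integralZl//; last 3 first.
- exact: (@measurable_fun_fubini_tonelli_G _ _ _ _ _ lebesgue_measure K mK K0).
- by move=> y _; exact: integral_ge0.
- by rewrite lee_fin invr_ge0 ltW.
rewrite -(@fubini_tonelli _ _ _ _ _ lebesgue_measure nu K mK K0).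
rewrite muleC lee_pdivrMr//.
apply: (@le_trans _ _ (\int[lebesgue_measure]_(r in `[0%R, l]) (cst b%:E r))%E).
  rewrite [leRHS]integral_mkcond.
  apply: ge0_le_integral => //.
  - by move=> r _; exact: integral_ge0.
  - exact: (@measurable_fun_fubini_tonelli_F _ _ _ _ _ nu K mK K0).
  - by apply/measurable_restrict.
  - move=> r _; rewrite patchE; case: ifPn => rl.
      rewrite /K/= indicE rl; under eq_integral do rewrite mulr1.
      by apply: int_le; move: rl; rewrite inE/= in_itv.
    rewrite /K/= indicE (negbTE rl); under eq_integral do rewrite mulr0.
    by rewrite integral0.
by rewrite integral_cst//= lebesgue_measure_0l.
Qed.

End OrbitAverage.

(** * The Ornstein-Uhlenbeck semigroup on orbit averages *)

(** Where |y z| < a, the Lipschitz bound gives L a. Elsewhere [phi] varies by at most 2, on a set of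
    mass at most 6 C y y / a^2. *)
Lemma gaussian_perturbation (R : realType) (E : normedModType R)
    (C : (E -> R) -> (E -> R) -> R) (nu : probability (borel E) R)
    (phi : R -> R) (L a u : R) (y : {scalar E}) :
  0 <= L -> (forall v, `|phi v| <= 1) ->
  (forall v w, `|phi v - phi w| <= L * `|v - w|) ->
  centred_gaussian C nu -> continuous y -> 0 <= C y y -> 0 < a ->
  (\int[nu]_z `|phi (u + y z) - phi u|%:E <= (L * a + 12 * C y y / a ^+ 2)%:E)%E.
Proof.
move=> L0 phi1 phiL gnu cy C0 a0; pose A := [set z : borel E | a <= `|y z|].
have my : measurable_fun [set: borel E] (y : borel E -> R).
  exact: continuous_borel_measurable.
have mA : measurable A.
  rewrite -[A]setTI; apply: measurable_fun_le => //.
  exact: measurableT_comp.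
have mtail : measurable [set v : R | a <= `|v|].
  by rewrite -[X in measurable X]setTI; apply: measurable_fun_le.
have cphi : continuous phi.
  exact: (unif_continuous_continuous _ R R phi (lipschitz_unif_continuous _ R R phi _ L0 phiL)).
have mphi : measurable_fun [set: borel E] (fun z => `|phi (u + y z) - phi u|).
  apply: measurableT_comp => //; apply: measurable_funB => //.
  apply: (measurableT_comp (continuous_measurable_fun cphi)).
  exact: measurable_funD.
apply: (@le_trans _ _ (\int[nu]_z ((L * a)%:E + 2%:E * (\1_A z)%:E))%E).
  apply: ge0_le_integral => //.
  - exact/measurable_EFinP.
  - apply: emeasurable_funD => //; apply: measurable_funeM.
    by apply/measurable_EFinP; exact: measurable_indic.
  - move=> z _; rewrite -EFinM -EFinD lee_fin indicE.
    have [zA|/negP zA] := boolP (z \in A).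
      rewrite mulr1 (le_trans (ler_normB _ _))//.
      have := phi1 (u + y z); have := phi1 u.
      have : 0 <= L * a by rewrite mulr_ge0// ltW.
      by lra.
    rewrite mulr0 addr0 (le_trans (phiL _ _))// addrAC subrr add0r ler_wpM2l//.
    rewrite ltW// ltNge; apply/negP => az; apply: zA; exact/mem_set.
rewrite ge0_integralD//; last 2 first.
- by move=> z _; rewrite lee_fin mulr_ge0// ltW.
- by apply: measurable_funeM; apply/measurable_EFinP; exact: measurable_indic.
rewrite integral_cst// ge0_integralZl//; last first.
  by apply/measurable_EFinP; exact: measurable_indic.
rewrite integral_indic// setIT (EFinD (L * a)) leeD//; first by rewrite /= probability_setT mule1.
have nuA : (nu A <= (6 * C y y / a ^+ 2)%:E)%E.
  by rewrite (le_trans _ (centred_normal_tail _ _ _ C0 a0))// -gnu.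
apply: le_trans (lee_wpmul2l _ nuA) _ => //.
by rewrite -EFinM lee_fin mulrA mulrA -natrM.
Qed.

(** The bound c guarantees that [sup] is a genuine supremum. *)
Lemma le_supnorm (R : realType) (E : completeNormedModType R) (g : E -> R) c x :
  (forall y, `|g y| <= c) -> `|g x| <= supnorm g.
Proof.
by move=> gc; apply: ub_le_sup; [exists c => _ [y _ <-]|exists x].
Qed.

Lemma supnorm_le (R : realType) (E : completeNormedModType R) (g : E -> R) c :
  (forall y, `|g y| <= c) -> 0 <= supnorm g <= c.
Proof.
move=> gc; rewrite (le_trans (normr_ge0 (g 0)) (le_supnorm _ _ _ _ 0 gc))/=.
by apply: ge_sup; [exists `|g 0|, 0|move=> _ [y _ <-]].
Qed.

Lemma OU_contraction (R : realType) (E : completeNormedModType R)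
    (S : R -> {linear E -> E}) (mu : R -> probability (borel E) R) t f x :
  BUC f -> supnorm f <= 1 -> `|OU S mu t f x| <= 1.
Proof.
move=> [bf /unif_continuous_continuous cf] f1; rewrite /OU.
have {}f1 y : `|f y| <= 1.
  have [c [_ /(_ (c + 1))]] := bf; rewrite ltrDl => /(_ ltr01) fc.
  by apply: le_trans f1; apply: (le_supnorm _ _ _ (c + 1)) => z; exact: fc.
have mf : measurable_fun [set: borel E] (fun y => f (S t x + y)).
  apply: continuous_borel_measurable => y; apply: continuous_comp; last exact: cf.
  by apply: cvgD; [exact: cvg_cst|exact: cvg_id].
have := @normr_Rintegral_le _ _ _ (mu t) setT (fun y => f (S t x + y)) 1.
rewrite /= probability_setT mul1r; apply => //.
exact: ltry.
Qed.

Section OrnsteinUhlenbeckAverage.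
Context {R : realType} {E H : completeNormedModType R}.
Variables (ip : H -> H -> R) (S : R -> {linear E -> E}) (B : {linear H -> E}).
Variable mu : R -> probability (borel E) R.
Hypothesis ipP : inner_product ip.
Hypothesis C0S : C0_semigroup S.
Hypothesis gaussian_mu : forall t, 0 <= t ->
  radon (mu t) /\ centred_gaussian (Qt_pairing ip S B t) (mu t).
Variables (b eta M : R).
Hypothesis Bb : forall k, `|B k| <= b * `|k|.
Hypothesis M0 : 0 <= M.
Hypothesis MP : forall t x, 0 <= t <= eta -> `|S t x| <= M * `|x|.
Variables (xi : {scalar E}) (phi : R -> R) (L l : R).
Hypothesis xi1 : forall z, `|xi z| <= `|z|.
Hypothesis L0 : 0 <= L.
Hypothesis phi1 : forall u, `|phi u| <= 1.
Hypothesis phiL : forall u v, `|phi u - phi v| <= L * `|u - v|.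
Hypothesis l0 : 0 < l.

Let avg := orbit_average S xi phi l.

(** Under [mu h] each xi o S(r) with r <= l is centred normal of variance at most (M b)^2 h, because
    r + s <= eta for all s <= h. The bound is uniform in [x], with two uses: h tends to 0 for
    membership in BUC^o, and L is made small at fixed h for the separation. *)
Lemma OU_average_dist h a x : 0 <= h -> h + l <= eta -> 0 < a ->
  `|OU S mu h avg x - avg (S h x)| <= L * a + 12 * ((M * b) ^+ 2 * h) / a ^+ 2.
Proof.
move=> h0 hl a0; have [_ gh] := gaussian_mu _ h0.
have avgL := orbit_average_lipschitz _ _ _ _ C0S xi1 L0 phi1 phiL _ l0 _ M0.
apply: (@orbit_average_convolution _ _ _ _ _ _ C0S xi1 L0 phi1 phiL _ l0 _ _ (L * M)).
- by rewrite mulr_ge0.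
- apply: avgL => t z /andP[t0 tl]; apply: MP; rewrite t0 (le_trans tl)//.
  by rewrite (le_trans _ hl)// lerDr.
move=> r /andP[r0 rl].
pose y : {scalar E} := xi \o S r.
have SrM s z : 0 <= s <= h -> `|y (S s z)| <= M * `|z|.
  move=> /andP[s0 sh]; have -> : y (S s z) = xi (S (r + s) z).
    by case: C0S => _ _ -> .
  rewrite (le_trans (xi1 _))// MP// addr_ge0//= (le_trans _ hl)// addrC lerD//.
have cy : continuous y.
  apply: unif_continuous_continuous.
  apply: (@lipschitz_unif_continuous _ _ _ _ M) => // z w.
  (* At time s = 0 the bound [SrM] is a bound on y itself. *)
  have [_ S0 _ _] := C0S; have := SrM 0 (z - w).
  by rewrite S0 lexx h0 linearB => /(_ isT).
have := Qt_pairing_bound ip S B ipP y b M h h0 Bb SrM M0.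
move=> /andP[Q0 Qle].
apply: le_trans (_ : (L * a + 12 * Qt_pairing ip S B h y y / a ^+ 2)%:E <= _)%E; last first.
  by rewrite lee_fin lerD2l ler_wpM2r ?ler_wpM2l// invr_ge0 sqr_ge0.
have := gaussian_perturbation _ _ _ _ _ _ _ (y (S h x)) _ L0 phi1 phiL gh cy Q0 a0.
apply: le_trans; rewrite le_eqVlt; apply/orP; left; apply/eqP.
by apply: eq_integral => z _; rewrite /orbit_value max_r// !linearD.
Qed.

Lemma orbit_average_BUCo : l < eta -> BUCo S mu avg.
Proof.
move=> leta; split; first split.
- exists 1; split; first exact: num_real.
  move=> c c1 x _; apply: le_trans (ltW c1).
  exact: (orbit_average_bound _ _ _ _ C0S xi1 L0 phi1 phiL).
- apply: (@lipschitz_unif_continuous _ _ _ _ (L * M)); first exact: mulr_ge0.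
  apply: (orbit_average_lipschitz _ _ _ _ C0S xi1 L0 phi1 phiL _ l0 _ M0) => t z.
  by move=> /andP[t0 tl]; apply: MP; rewrite t0 (le_trans tl)// ltW.
(* This choice makes L a <= e/3, also when L = 0. The Gaussian tail and the flow displacement are
   then linear in h, with total slope k. *)
apply/cvgrPdist_le => e e0; pose a := e / 3 / (L + 1).
have L1 : 0 < L + 1 by rewrite ltr_wpDl.
have a0 : 0 < a by rewrite !divr_gt0.
pose k := 12 * (M * b) ^+ 2 / a ^+ 2 + 2 / l.
have k0 : 0 < k.
  by rewrite ltr_wpDl ?divr_gt0// divr_ge0 ?sqr_ge0// mulr_ge0// sqr_ge0.
near=> h.
have h0 : 0 < h by near: h; exact: nbhs_right_gt.
have hl : h + l <= eta.
  by rewrite -lerBrDr; near: h; apply: nbhs_right_ltW; rewrite subr_gt0.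
have hk : h * k <= e / 3 * 2.
  rewrite -ler_pdivlMr//; near: h; apply: nbhs_right_ltW.
  by rewrite divr_gt0// mulr_gt0// divr_gt0.
have La : L * a <= e / 3.
  rewrite /a mulrA ler_pdivrMr// mulrC ler_wpM2l ?lerDl//.
  by rewrite divr_ge0// ltW.
have dist x : `|(OU S mu h avg \- avg) x| <= e.
  rewrite /=; have -> : OU S mu h avg x - avg x =
      (OU S mu h avg x - avg (S h x)) + (avg (S h x) - avg x).
    by rewrite addrA subrK.
  rewrite (le_trans (ler_normD _ _))//.
  have := OU_average_dist h a x (ltW h0) hl a0.
  have := orbit_average_flow _ _ _ _ C0S xi1 L0 phi1 phiL _ l0 h x (ltW h0).
  have kE : 12 * ((M * b) ^+ 2 * h) / a ^+ 2 + 2 * h / l = h * k.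
    by rewrite /k; field; rewrite !gt_eqF.
  by move: hk La; rewrite -kE -/avg; lra.
have /andP[s0 s1] := supnorm_le _ _ _ _ dist.
by rewrite sub0r normrN ger0_norm.
Unshelve. all: by end_near. Qed.

End OrnsteinUhlenbeckAverage.

(** * Norm discontinuity *)

Definition clamp {R : realType} (w : R) : R := Num.max (-1) (Num.min 1 w).

Lemma clamp_le1 (R : realType) (w : R) : `|clamp w| <= 1.
Proof. by rewrite /clamp ler_norml le_max ge_max ge_min !lexx /=; lra. Qed.

Lemma clamp_ge1 (R : realType) (w : R) : 1 <= w -> clamp w = 1.
Proof. by move=> w1; rewrite /clamp min_l// max_r//; lra. Qed.

Lemma clamp_leN1 (R : realType) (w : R) : w <= -1 -> clamp w = -1.
Proof. by move=> w1; rewrite /clamp min_r ?max_l//; lra. Qed.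

Lemma clamp_dist (R : realType) (v w : R) : `|clamp v - clamp w| <= `|v - w|.
Proof.
have clampE (u : R) : [\/ u <= -1 /\ clamp u = -1, 1 <= u /\ clamp u = 1 |
    -1 <= u <= 1 /\ clamp u = u].
  have [uN1|uN1] := leP u (-1); first by constructor 1; rewrite clamp_leN1.
  have [u1|u1] := leP 1 u; first by constructor 2; rewrite clamp_ge1.
  by constructor 3; rewrite /clamp min_r ?max_r ?(ltW uN1) ?(ltW u1).
rewrite ler_norml; have := ler_norm (v - w); have := ler_norm (- (v - w)).
rewrite normrN.
by case: (clampE v) => -[? ->]; case: (clampE w) => -[? ->]; lra.
Qed.

Section Discontinuity.
Context {R : realType} {E H : completeNormedModType R}.
Variables (ip : H -> H -> R) (S : R -> {linear E -> E}) (B : {linear H -> E}).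
Variable mu : R -> probability (borel E) R.
Hypothesis ipP : inner_product ip.
Hypothesis C0S : C0_semigroup S.
Hypothesis gaussian_mu : forall t, 0 <= t ->
  radon (mu t) /\ centred_gaussian (Qt_pairing ip S B t) (mu t).
Variables (b eta M : R).
Hypothesis Bb : forall k, `|B k| <= b * `|k|.
Hypothesis M0 : 0 <= M.
Hypothesis MP : forall t x, 0 <= t <= eta -> `|S t x| <= M * `|x|.
Variable xi : {scalar E}.
Hypothesis xi1 : forall z, `|xi z| <= `|z|.

Lemma OU_separation s t x e : 0 <= s < eta -> 0 <= t < eta ->
  xi (S s x) < xi (S t x) -> 0 < e ->
  exists f, [/\ BUCo S mu f, forall z, `|f z| <= 1
    & exists z, 2 - e <= OU S mu t f z - OU S mu s f z].
Proof.
move=> /andP[s0 seta] /andP[t0 teta] st e0.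
(* The two values of [xi] are m - 2 rho and m + 2 rho. A drift of at most rho inside the window
   keeps them outside ]m - rho, m + rho[, where the clamp is saturated. *)
pose rho := (xi (S t x) - xi (S s x)) / 4; pose m := (xi (S t x) + xi (S s x)) / 2.
have rho0 : 0 < rho by rewrite divr_gt0// subr_gt0.
have [d1 d10 d1P] := orbit_continuous0 _ C0S (S s x) _ rho0.
have [d2 d20 d2P] := orbit_continuous0 _ C0S (S t x) _ rho0.
(* The window is shorter than d1 and d2 to limit the drift, and keeps s + l and t + l below eta;
   halving makes this strict. *)
pose l := Num.min (Num.min d1 d2) (Num.min (eta - s) (eta - t)) / 2.
have m0 : 0 < Num.min (Num.min d1 d2) (Num.min (eta - s) (eta - t)).
  by rewrite !lt_min d10 d20 !subr_gt0 seta.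
have l0 : 0 < l by rewrite divr_gt0.
have : l < Num.min (Num.min d1 d2) (Num.min (eta - s) (eta - t)).
  by rewrite ltr_pdivrMr// ltr_pMr// ltr1n.
rewrite !lt_min => /andP[/andP[ld1 ld2] /andP[ls lt]].
pose k := 12 * ((M * b) ^+ 2 * eta).
have eta0 : 0 < eta by exact: le_lt_trans s0 seta.
have k0 : 0 <= k by rewrite /k mulr_ge0// mulr_ge0 ?sqr_ge0// ltW.
(* First a makes the tail term k / a^2 at most e/4; then N makes L a equal to e/4. *)
pose a := 1 + k * 4 / e; pose N := a * 4 / (rho * e).
have ke0 : 0 <= k * 4 / e by rewrite divr_ge0 ?(ltW e0)// mulr_ge0.
have a0 : 0 < a by rewrite ltr_wpDr.
have N0 : 0 < N by rewrite /N divr_gt0// mulr_gt0.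
pose L := (rho * N)^-1; pose phi u := clamp ((u / N - m) / rho).
have L0 : 0 <= L by rewrite invr_ge0 mulr_ge0// ltW.
have phi1 u : `|phi u| <= 1 by exact: clamp_le1.
have phiL u v : `|phi u - phi v| <= L * `|u - v|.
  rewrite (le_trans (clamp_dist _ _ _))//.
  have -> : (u / N - m) / rho - (v / N - m) / rho = L * (u - v).
    by rewrite /L; field; rewrite !gt_eqF.
  by rewrite normrM ger0_norm.
pose f := orbit_average S xi phi l.
(* Evaluating at N x cancels the division by N inside [phi], so the values do not depend on N
   although L does. *)
have valE q c : 0 <= q -> (forall r, 0 <= r <= l -> clamp ((xi (S r (S q x)) - m) / rho) = c) ->
    f (S q (N *: x)) = c.
  move=> q0 cE; apply: orbit_average_eq => // r rl; rewrite -(cE r rl).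
  case/andP: rl => r0 _; rewrite /orbit_value /phi max_r// !linearZ /=.
  by rewrite mulrAC divff ?mul1r// gt_eqF.
have fs : f (S s (N *: x)) = -1.
  apply: valE => // r /andP[r0 rl]; apply: clamp_leN1.
  rewrite ler_pdivrMr//.
  have := d1P r; rewrite r0 (le_lt_trans rl ld1) => /(_ isT).
  move=> /(le_trans (xi1 _)); rewrite linearB /= => /ler_normlP[_].
  by rewrite /m /rho; lra.
have ft : f (S t (N *: x)) = 1.
  apply: valE => // r /andP[r0 rl]; apply: clamp_ge1.
  rewrite ler_pdivlMr//.
  have := d2P r; rewrite r0 (le_lt_trans rl ld2) => /(_ isT).
  move=> /(le_trans (xi1 _)); rewrite linearB /= => /ler_normlP[+ _].
  by rewrite /m /rho; lra.
have dist q : 0 <= q -> q < eta -> l < eta - q ->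
    `|OU S mu q f (N *: x) - f (S q (N *: x))| <= e / 2.
  move=> q0 qeta lq.
  have ql : q + l <= eta by rewrite -lerBrDl ltW.
  apply: le_trans (OU_average_dist _ _ _ _ ipP C0S gaussian_mu _ _ _ Bb M0 MP _ _ _ _
    xi1 L0 phi1 phiL l0 _ _ _ q0 ql a0) _.
  have -> : L * a = e / 4 by rewrite /L /N; field; rewrite !gt_eqF.
  have kq : 12 * ((M * b) ^+ 2 * q) <= k.
    by rewrite ler_wpM2l// ler_wpM2l ?sqr_ge0// ltW.
  suff : 12 * ((M * b) ^+ 2 * q) / a ^+ 2 <= e / 4 by lra.
  rewrite ler_pdivrMr ?exprn_gt0// (le_trans kq)//.
  have -> : k = e / 4 * (a - 1) by rewrite /a; field; rewrite gt_eqF.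
  rewrite ler_wpM2l ?divr_ge0 ?ltW//.
  have : 1 <= a by rewrite /a lerDl.
  by rewrite expr2; nra.
exists f; split.
- apply: (orbit_average_BUCo _ _ _ _ ipP C0S gaussian_mu _ eta _ Bb M0 MP _ _ _ _
    xi1 L0 phi1 phiL l0).
  by rewrite (lt_le_trans ls)// gerBl.
- by move=> z; exact: (orbit_average_bound _ _ _ _ C0S xi1 L0 phi1 phiL).
exists (N *: x).
have := dist s s0 seta ls; have := dist t t0 teta lt; rewrite fs ft.
by move=> /ler_normlP[+ _] /ler_normlP[_]; lra.
Qed.

(** The upper bound adds two contractions; [OU_separation] comes within every e > 0 of it, and
    attainment is not claimed. *)
Lemma opnorm_OU s t x : 0 <= s < eta -> 0 <= t < eta ->
  xi (S s x) < xi (S t x) ->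
  opnorm (BUCo S mu) (fun f => OU S mu t f \- OU S mu s f) = 2.
Proof.
move=> seta teta st; rewrite /opnorm; set A := (X in sup X).
have ubA f : BUCo S mu f -> supnorm f <= 1 ->
    forall z, `|(OU S mu t f \- OU S mu s f) z| <= 2.
  move=> [bf _] f1 z; rewrite /= (le_trans (ler_normB _ _))//.
  by rewrite -[2]/(1 + 1) lerD// OU_contraction.
have A2 : ubound A 2.
  by move=> _ [f [Bf f1] <-]; have /andP[] := supnorm_le _ _ _ _ (ubA f Bf f1).
have sepA e : 0 < e -> exists2 v, A v & 2 - e <= v.
  move=> e0; have [f [Bf f1 [z fz]]] := OU_separation s t x e seta teta st e0.
  have /andP[_ sf1] := supnorm_le _ _ _ _ f1.
  exists (supnorm (OU S mu t f \- OU S mu s f)); first by exists f.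
  apply: le_trans (le_supnorm _ _ _ _ z (ubA f Bf sf1)).
  by rewrite (le_trans fz)//= ler_norm.
apply/eqP; rewrite eq_le; apply/andP; split.
  by apply: ge_sup => //; have [v Av _] := sepA 1 ltr01; exists v.
apply/ler_addgt0Pr => e e0; have [v Av ev] := sepA e e0.
rewrite -lerBlDr (le_trans ev)//; apply: ub_le_sup => //.
by exists 2.
Qed.

End Discontinuity.

Theorem corollary2p5 (R : realType) (E H : completeNormedModType R)
    (ip : H -> H -> R) (S : R -> {linear E -> E}) (B : {linear H -> E})
    (mu : R -> probability (borel E) R) :
  inner_product ip ->
  C0_semigroup S ->
  continuous B ->
  (forall t, 0 <= t ->
     radon (mu t) /\ centred_gaussian (Qt_pairing ip S B t) (mu t)) ->
  (exists2 x, generator_domain S x & generator S x <> 0) ->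
  exists2 t0 : R, 0 < t0 &
    forall t s : R, 0 <= t <= t0 -> 0 <= s <= t0 -> t <> s ->
      opnorm (BUCo S mu) (fun f => OU S mu t f \- OU S mu s f) = 2.
Proof.
move=> ipP C0S cB gaussian_mu [x Dx /eqP Ax0].
have [b _ Bb] := continuous_linear_normP _ _ _ _ cB.
have [eta eta0 [M M0 MP]] := semigroup_locally_bounded _ C0S.
have [xi [xi1 xiA]] := norming_functional (generator S x).
have [|t0 t00 incr] := functional_orbit_increasing _ C0S xi x xi1 Dx.
  by rewrite xiA normr_gt0.
(* Halving eta leaves room for a window of positive length after time t. *)
exists (Num.min t0 (eta / 2)); first by rewrite lt_min t00 divr_gt0.
have main s t : 0 <= s -> s < t -> t <= Num.min t0 (eta / 2) ->
    opnorm (BUCo S mu) (fun f => OU S mu t f \- OU S mu s f) = 2.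
  move=> s0 st; rewrite le_min => /andP[tt0 teta].
  have eta2 : eta / 2 < eta by lra.
  apply: (opnorm_OU _ _ _ _ ipP C0S gaussian_mu _ eta _ Bb (ltW M0) (fun t x => MP t x)
    _ xi1 _ _ x).
  - by rewrite s0/= (lt_le_trans st)// (le_trans teta)// ltW.
  - by rewrite (ltW (le_lt_trans s0 st))/= (le_lt_trans teta).
  - exact: incr.
move=> t s /andP[tge0 tle] /andP[sge0 sle] /eqP; rewrite neq_lt => /orP[ts|st].
  (* For t < s the roles are exchanged: the norm only sees |P(t)f - P(s)f|, which is symmetric. *)
  rewrite -(main t s)//; congr sup; apply/eq_imagel => f _.
  rewrite /supnorm; congr sup; apply/eq_imagel => z _ /=.
  by rewrite distrC.
exact: main.
Qed.
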